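(* Let $T$ be a connected caterpillar with $m_t(T)\le 5$. Then $\varphi_t(T)=m_t(T)$.
   Context: A caterpillar is a tree $T$ having a central path $\mathcal{P}$ (the path formed by its non-leaf vertices; empty if $T\cong K_1$ or $K_2$) such that every leaf of $T$ is at distance one from $\mathcal{P}$. For a simple graph $G=(V,E)$: elements are members of $V\cup E$; two elements are adjacent if they are adjacent vertices, a vertex and an edge incident to it, or two distinct edges sharing an endpoint. $N_t(x)$ is the set of elements adjacent to $x$ and $d_t(x)=|N_t(x)|$ (so $d_t(v)=2d(v)$ for a vertex, $d_t(uv)=d(u)+d(v)$ for an edge). A total $k$-colouring is a surjective map $\mathbf{c}:V\cup E\to\{1,\dots,k\}$ giving adjacent elements different colours. An element $x$ is total b-chromatic if $\mathbf{c}(N_t(x))=\{1,\dots,k\}\setminus\{\mathbf{c}(x)\}$; a total b-chromatic $k$-colouring has a total b-chromatic element in every colour class; $\varphi_t(G)$ is the maximum such $k$. With elements ordered by non-increasing total degree $d_t(x_1)\ge d_t(x_2)\ge\cdots$, the total $m$-degree is $m_t(G)=\max\{i: d_t(x_i)\ge i-1\}$. *)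

(* Defs.v *)
From mathcomp Require Import all_boot.

Set Implicit Arguments.
Unset Strict Implicit.
Unset Printing Implicit Defensive.

Record sgraph := SGraph {
  vertex :> finType;
  adj : rel vertex;
  adj_sym : symmetric adj;
  adj_irrefl : irreflexive adj }.

Section Trees.
Variable G : sgraph.

Definition degree (v : G) : nat := #|[set u | adj v u]|.

Definition is_leaf (v : G) : bool := degree v == 1.

Definition connected_graph : Prop := forall u v : G, connect (@adj G) u v.

(* [ucycle] also accepts the sequences [::] and [:: u; v] with u, v adjacent;
   the genuine cycles of a simple graph are those with at least 3 vertices. *)
Definition acyclic_graph : Prop :=
  forall p : seq G, 3 <= size p -> ~ ucycle (@adj G) p.

Definition is_tree : Prop := [/\ 0 < #|G|, connected_graph & acyclic_graph].

(* [p] lists the non-leaf vertices in the order of a path; since a leaf is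
   never on [p], being at distance one from [p] is being adjacent to one of
   its vertices. *)
Definition is_central_path (p : seq G) : Prop :=
  [/\ uniq p, sorted (@adj G) p & forall v, (v \in p) = ~~ is_leaf v].

(* The trees on at most two vertices are K_1 and K_2, the caterpillars whose
   central path is empty. *)
Definition is_caterpillar : Prop :=
  is_tree /\
  (#|G| <= 2 \/
   exists2 p : seq G, is_central_path p &
     forall v, is_leaf v -> exists2 u, u \in p & adj v u).

End Trees.

Section TotalColourings.
Variable G : sgraph.

Definition edges : {set {set G}} :=
  [set f | [exists u, exists v, adj u v && (f == [set u; v])]].

Definition edge : finType := {f : {set G} | f \in edges}.

Definition element : finType := (G + edge)%type.

Definition tadj (x y : element) : bool :=
  match x, y with
  | inl u, inl v => adj u v
  | inl u, inr f => u \in val f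
  | inr f, inl u => u \in val f
  | inr f, inr g => (f != g) && (val f :&: val g != set0)
  end.

Definition N_t (x : element) : {set element} := [set y | tadj x y].

Definition d_t (x : element) : nat := #|N_t x|.

Definition total_colouring (k : nat) (c : {ffun element -> 'I_k}) : bool :=
  [forall i, exists x, c x == i] &&
  [forall x, forall y, tadj x y ==> (c x != c y)].

Definition total_b_chromatic (k : nat) (c : {ffun element -> 'I_k})
    (x : element) : bool :=
  c @: N_t x == [set~ c x].

Definition total_b_colouring (k : nat) (c : {ffun element -> 'I_k}) : bool :=
  total_colouring c &&
  [forall i, exists x, (c x == i) && total_b_chromatic c x].

Definition has_total_b_colouring (k : nat) : bool :=
  [exists c : {ffun element -> 'I_k}, total_b_colouring c].

(* Surjectivity of colourings forces k <= #|element|, so the bound on k is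
   harmless. *)
Definition phi_t : nat :=
  \max_(k < #|element|.+1 | has_total_b_colouring k) k.

Definition degree_seq : seq nat :=
  sort geq [seq d_t x | x <- enum element].

(* The 0-based index i stands for the (i+1)-st largest total degree. *)
Definition m_t : nat :=
  \max_(i < size degree_seq | i <= nth 0 degree_seq i) i.+1.

Lemma has_total_b_colouring_leq k : has_total_b_colouring k -> k <= #|element|.
Proof.
case/existsP=> c /andP[/andP[/forallP surj _] _].
have <- : #|c @: [set: element]| = k.
  rewrite -[RHS]card_ord -cardsT; congr #|pred_of_set _|.
  apply/setP=> i; rewrite inE; case/existsP: (surj i) => x /eqP <-.
  by rewrite imset_f.
by rewrite (leq_trans (leq_imset_card _ _)) // cardsT.
Qed.

Lemma leq_phi_t k : has_total_b_colouring k -> k <= phi_t.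
Proof.
move=> Hk; have lek : k < #|element|.+1 by exact: has_total_b_colouring_leq.
exact: (@leq_bigmax_cond _ _ (fun i : 'I_(#|element|.+1) => val i) (Ordinal lek)).
Qed.

Lemma phi_t_attained k :
  has_total_b_colouring k -> has_total_b_colouring phi_t.
Proof.
move=> Hk; have lek : k < #|element|.+1 by exact: has_total_b_colouring_leq.
rewrite /phi_t (bigmax_eq_arg (Ordinal lek)) //.
by case: arg_maxnP.
Qed.

End TotalColourings.

(* Main.v *)
Require Import Defs.
From mathcomp Require Import all_boot.

Set Implicit Arguments.
Unset Strict Implicit.
Unset Printing Implicit Defensive.

(* A [k]-colouring with b-chromatic elements gives [k] elements of total degree
   at least [k - 1], so [phi_t <= m_t]. For the converse, if a tree has maximum
   degree less than [k] and [2 < k], a total [k]-colouring of a subtree extends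
   greedily, one pendant vertex at a time, and elements that are b-chromatic in
   the subtree stay so. Hence it suffices to find a small subtree with a
   b-colouring by [m_t] colours. A vertex is of degree less than [m_t <= 5], and
   the cases are: degree 4, the star K_{1,4} (5 colours); degree 3, the star
   K_{1,3} with one edge subdivided (5 colours) unless the tree is K_{1,3}
   (4 colours); degree at most 2, the paths P_5, P_4 and P_2 (5, 4 and 3
   colours). In each case the absence of the larger subtree bounds [m_t]. *)

(** * Non-increasing sequences and counting *)

Lemma geq_trans : transitive geq.
Proof. by move=> a b c leab leca; apply: leq_trans leca leab. Qed.

(** In a non-increasing sequence the entries that are at least [j] form a prefix. This turns the
    sorted definition of [m_t] into a count of elements. *)
Lemma sorted_geq_count (s : seq nat) (i j : nat) :
  sorted geq s -> i < size s -> (j <= nth 0 s i) = (i < count (leq j) s).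
Proof.
elim: s i => [|x s IHs] // i sorted_xs; have sorted_s := path_sorted sorted_xs.
have small y : y \in s -> y <= x by move/(order_path_min geq_trans)/allP: sorted_xs; apply.
have count0 : x < j -> count (leq j) s = 0.
  move=> ltxj; apply/eqP; rewrite eqn0Ngt -has_count; apply/hasPn => y /small leyx.
  by rewrite -ltnNge (leq_ltn_trans leyx).
case: i => [|i] lt_is /=; first by case: (leqP j x) => [_|/count0 ->]; rewrite ?add1n.
by rewrite IHs //; case: (leqP j x) => [_|/count0 ->]; rewrite ?add1n.
Qed.

(** * Total degrees, bounds on the total m-degree, and the upper bound on [phi_t] *)

Section TotalDegree.
Variable G : sgraph.
Implicit Types (u v w : G) (f g : edge G) (x y : element G) (A : {set G}).

Definition incident v : {set edge G} := [set f : edge G | v \in val f].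

Lemma edgeP f : exists u v, adj u v /\ val f = [set u; v].
Proof.
have := valP f; rewrite inE => /existsP[u /existsP[v /andP[uv /eqP ->]]].
by exists u, v.
Qed.

Lemma adj_edge u v : adj u v -> exists f, val f = [set u; v].
Proof.
move=> uv; have fE : [set u; v] \in edges G.
  by rewrite inE; apply/existsP; exists u; apply/existsP; exists v; rewrite uv /=.
by exists (exist (fun F => F \in edges G) _ fE).
Qed.

Lemma adj_neq u v : adj u v -> u != v.
Proof. by move=> uv; apply/eqP => E; move: uv; rewrite E adj_irrefl. Qed.

Lemma edge_otherP f v : v \in val f -> exists2 u, adj v u & val f = [set v; u].
Proof.
have [a [b [ab ->]]] := edgeP f; rewrite !inE => /orP[]/eqP->; first by exists b.
by exists a; rewrite 1?adj_sym // setUC.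
Qed.

Lemma set2_inj v : injective (fun u => [set v; u]).
Proof.
move=> a b E; have := set22 v a; rewrite E !inE => /orP[]/eqP // av.
by have := set22 v b; rewrite -E av !inE orbb => /eqP.
Qed.

(** Incident edges and neighbours are both counted through the sets [[set v; u]], to which each maps
    injectively. *)
Lemma card_incident v : #|incident v| = degree v.
Proof.
rewrite /degree -(card_imset _ val_inj) -(card_imset [set u | adj v u] (@set2_inj v)).
congr #|pred_of_set _|; apply/setP => F; apply/imsetP/imsetP.
  case=> f; rewrite inE => /edge_otherP[u vu fE] ->.
  by exists u; rewrite ?inE.
case=> u; rewrite inE => vu ->; have [f fE] := adj_edge vu.
by exists f; rewrite // inE fE set21.
Qed.

Lemma card_element (A : {set element G}) :
  #|A| = #|[set v | inl v \in A]| + #|[set f : edge G | inr f \in A]|.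
Proof.
rewrite -(card_imset _ (@inl_inj G (edge G))) -(card_imset _ (@inr_inj G (edge G))).
rewrite -cardsUI -[LHS]addn0; congr (_ + _); last first.
  apply/esym/eqP; rewrite cards_eq0 -subset0; apply/subsetP => -[v|f].
    by rewrite inE => /andP[_ /imsetP[]].
  by rewrite inE => /andP[/imsetP[]].
congr #|pred_of_set _|; apply/setP => -[v|f]; rewrite inE.
  rewrite mem_imset ?inE //; last exact: inl_inj.
  by apply/esym/orb_idr => /imsetP[].
rewrite orbC mem_imset ?inE //; last exact: inr_inj.
by apply/esym/orb_idr => /imsetP[].
Qed.

Lemma d_t_vertex v : d_t (inl v) = (degree v).*2.
Proof.
rewrite /d_t card_element -addnn -{2}card_incident; congr (_ + _).
  by congr #|pred_of_set _|; apply/setP => u; rewrite !inE.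
by congr #|pred_of_set _|; apply/setP => f; rewrite !inE.
Qed.

(** The two ends count 2, and the other edges at [u] and at [v] add at most [(degree u).-1] and
    [(degree v).-1]; a union bound suffices for an inequality. *)
Lemma d_t_edge u v f : val f = [set u; v] -> d_t (inr f) <= degree u + degree v.
Proof.
move=> fE; rewrite /d_t card_element.
have -> : [set w | inl w \in N_t (inr f)] = val f.
  by apply/setP => w; rewrite !inE.
have fu : f \in incident u by rewrite inE fE set21.
have fv : f \in incident v by rewrite inE fE set22.
have : #|[set g | inr g \in N_t (inr f)]| <= (degree u).-1 + (degree v).-1.
  rewrite -!card_incident [#|incident u|](cardsD1 f) fu [#|incident v|](cardsD1 f) fv.
  apply: leq_trans (leq_card_setU _ _); apply: subset_leq_card; apply/subsetP => g.
  rewrite !inE => /andP[nfg /set0Pn[w]]; rewrite fE !inE (eq_sym g f) nfg /=.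
  by case/andP=> /orP[]/eqP-> ->; rewrite ?orbT.
have du : 0 < degree u by rewrite -card_incident; apply/card_gt0P; exists f.
have dv : 0 < degree v by rewrite -card_incident; apply/card_gt0P; exists f.
move=> le; have := leq_add (_ : #|val f| <= 2) le; rewrite {1}fE cards2.
case: (degree u) du le => // du _; case: (degree v) dv => // dv _ _.
by rewrite addSn addnS /= => -> //; case: eqP.
Qed.

Lemma d_t_leq (d : nat) x : (forall v, degree v <= d) -> d_t x <= d.*2.
Proof.
move=> led; case: x => [v|f]; first by rewrite d_t_vertex leq_double.
have [u [v [_ fE]]] := edgeP f.
by apply: leq_trans (d_t_edge fE) _; rewrite -addnn leq_add.
Qed.

(** The edge [f] is adjacent to [v] and to the other edges at [v]. *)
Lemma degree_leq_d_t v f : v \in val f -> degree v <= d_t (inr f).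
Proof.
move=> vf; rewrite -card_incident (cardsD1 f) inE vf /= /d_t card_element.
apply: leq_add.
  by apply/card_gt0P; exists v; rewrite !inE.
apply: subset_leq_card; apply/subsetP => g; rewrite !inE (eq_sym g) /= => /andP[-> vg] /=.
by apply/set0Pn; exists v; rewrite inE vf.
Qed.

Lemma count_degree_seq (k : nat) :
  count (leq k) (degree_seq G) = #|[set x : element G | k <= d_t x]|.
Proof.
rewrite /degree_seq count_sort count_map cardE size_filter enumT.
by apply/eq_in_count => x _ /=; rewrite inE.
Qed.

(** Index [k], counted from 0, names the [k.+1]-st largest total degree and qualifies by
    [sorted_geq_count]; hence the strict inequalities. *)
Lemma leq_m_t (k : nat) : k < #|[set x : element G | k <= d_t x]| -> k < m_t G.
Proof.
move=> ltk; have lts : k < size (degree_seq G).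
  by apply: leq_trans ltk _; rewrite -count_degree_seq count_size.
apply: (@leq_bigmax_cond _ _ (fun i : 'I__ => i.+1) (Ordinal lts)) => /=.
by rewrite sorted_geq_count ?count_degree_seq //; apply: sort_sorted => a b; apply: leq_total.
Qed.

(** A qualifying index [i] with [k <= i] would give more than [i] elements of total degree at least
    [i], hence more than [k] of total degree at least [k]. *)
Lemma m_t_leq (k : nat) : #|[set x : element G | k <= d_t x]| <= k -> m_t G <= k.
Proof.
move=> lek; apply/bigmax_leqP => i; rewrite sorted_geq_count //; last first.
  by apply: sort_sorted => a b; apply: leq_total.
rewrite count_degree_seq => lti; rewrite ltnNge; apply/negP => leki.
have: k < #|[set x : element G | k <= d_t x]|; last by rewrite ltnNge lek.
apply: (leq_ltn_trans leki); apply: leq_trans lti _.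
by apply: subset_leq_card; apply/subsetP => x; rewrite !inE; apply: leq_trans leki.
Qed.

(** The vertex [v] and its incident edges are [(degree v).+1] elements of total degree at least
    [degree v]. *)
Lemma degree_lt_m_t v : degree v < m_t G.
Proof.
apply: leq_m_t; rewrite card_element -add1n leq_add //.
  by apply/card_gt0P; exists v; rewrite !inE d_t_vertex -addnn leq_addr.
rewrite -{1}card_incident; apply: subset_leq_card; apply/subsetP => f.
by rewrite !inE; apply: degree_leq_d_t.
Qed.

(** With [k.+1] colours a b-chromatic element sees [k] others, so the elements of total degree at
    least [k] receive every colour and number at least [k.+1]. *)
Lemma phi_t_leq_m_t : phi_t G <= m_t G.
Proof.
apply/bigmax_leqP => -[[//|k] ltk] /= /existsP[c /andP[_ /forallP bc]].
apply: leq_m_t; rewrite -[X in X <= _]card_ord.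
rewrite -[leqLHS]cardsT.
have -> : [set: 'I_k.+1] = c @: [set x | k <= d_t x].
  apply/esym/setP => i; rewrite inE; have /existsP[x /andP[/eqP <- /eqP bx]] := bc i.
  rewrite imset_f // inE /d_t; apply: leq_trans (leq_imset_card c _).
  by rewrite bx cardsC1 card_ord.
exact: leq_imset_card.
Qed.

End TotalDegree.

(** * Connected vertex sets in acyclic graphs *)

Section InducedSubtrees.
Variable G : sgraph.
Implicit Types (u v w x y : G) (A : {set G}).

Definition connected_in A :=
  {in A &, forall x y, connect [rel a b | [&& a \in A, b \in A & adj a b]] x y}.

Lemma connected_in1 v : connected_in [set v].
Proof. by move=> x y; rewrite !inE => /eqP-> /eqP->; apply: connect0. Qed.

Lemma connected_inU1 A u w :
  connected_in A -> u \in A -> adj u w -> connected_in (w |: A).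
Proof.
move=> cA uA uw.
have sub x y : x \in A -> y \in A ->
    connect [rel a b | [&& a \in w |: A, b \in w |: A & adj a b]] x y.
  move=> xA yA; apply: connect_sub (cA x y xA yA) => a b /= /and3P[aA bA ab].
  by apply: connect1; rewrite /= !inE aA bA ab !orbT.
move=> x y; rewrite !inE => /orP[/eqP->|xA] /orP[/eqP->|yA]; last exact: sub.
- exact: connect0.
- apply: connect_trans (sub _ _ uA yA); apply: connect1.
  by rewrite /= !inE eqxx uA adj_sym uw !orbT.
- apply: connect_trans (sub _ _ xA uA) _; apply: connect1.
  by rewrite /= !inE eqxx uA uw !orbT.
Qed.

(** A simple path from [x] to [y] inside [A], closed up through [w] outside [A], would be a cycle,
    of length at least 3 when [x] and [y] differ. *)
Lemma unique_neighbour A w x y :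
    acyclic_graph G -> connected_in A -> w \notin A ->
  x \in A -> y \in A -> adj w x -> adj w y -> x = y.
Proof.
move=> acG cA wA xA yA wx wy; apply/eqP; apply/negP => /negP nxy.
have /connectP[s0 path0 lasty] := cA x y xA yA.
move: lasty nxy wy yA; case/shortenP: path0 => s path_s uniq_s _ -> nxy wy yA.
apply: (acG [:: w, x & s]); first by case: s nxy {path_s uniq_s wy yA} => //; rewrite eqxx.
have sA : {subset s <= A}.
  elim: s x path_s {xA wx nxy wy yA uniq_s} => //= a s IHs x /andP[/and3P[_ aA _]].
  by move/IHs => sA z; rewrite inE => /predU1P[->|/sA].
rewrite /ucycle /= rcons_path /= wx adj_sym wy andbT.
rewrite (sub_path _ path_s) /=; last by move=> a b /and3P[].
apply/andP; split; last exact: uniq_s.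
rewrite inE; apply/norP; split; first by apply: contraNneq wA => ->.
by apply: contra wA => /sA.
Qed.

Lemma adj_closed_setT A v :
  connected_graph G -> v \in A ->
  (forall x y, x \in A -> adj x y -> y \in A) -> forall x, x \in A.
Proof.
move=> conG vA clA x; have /connectP[s path_s ->] := conG v x.
elim: s v vA path_s => //= a s IHs v vA /andP[va]; apply: IHs.
exact: clA va.
Qed.

End InducedSubtrees.

(** * Partial colourings and their greedy extension *)

Lemma fresh_colour (k : nat) (s : seq nat) : size s < k -> exists2 a, a < k & a \notin s.
Proof.
move=> ltsk; case: (boolP (all (mem s) (iota 0 k))) => [/allP sub|/allPn[a]].
  by have := uniq_leq_size (iota_uniq 0 k) sub; rewrite size_iota leqNgt ltsk.
by rewrite mem_iota /= => ltak nas; exists a.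
Qed.

Section PartialColourings.
Variable G : sgraph.
Implicit Types (u v w : G) (f g : edge G) (x y : element G) (A : {set G}).
Implicit Types (c : element G -> nat) (k : nat).

Definition inside A x : bool :=
  match x with inl v => v \in A | inr f => val f \subset A end.

(** Colours are plain numbers and [c] takes arbitrary values outside [A], so extending a colouring
    changes no type. The last clause includes surjectivity; its witnesses lie inside [A] and
    therefore survive when [A] grows. *)
Definition partial_b_colouring k A c : Prop :=
  [/\ forall x, inside A x -> c x < k,
      forall x y, inside A x -> inside A y -> tadj x y -> c x != c y &
      forall a, a < k -> exists x, [/\ inside A x, c x = a &
        forall b, b < k -> b != a -> exists y, [/\ inside A y, tadj x y & c y = b]]].

Lemma tadj_sym : symmetric (@tadj G).
Proof.
move=> [u|f] [v|g] //=; first exact: adj_sym.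
by rewrite eq_sym setIC.
Qed.

Lemma inside_subset A (B : {set G}) x : A \subset B -> inside A x -> inside B x.
Proof.
by move=> AB; case: x => [v|f] /=; [apply: (subsetP AB) | move/subset_trans; apply].
Qed.

Lemma partial_b_colouring_setT k c :
  partial_b_colouring k setT c -> has_total_b_colouring G k.
Proof.
move=> [ltc properc bc]; have inT x : inside setT x.
  by case: x => [v|f] /=; rewrite ?inE ?subsetT.
pose C := [ffun x => Ordinal (ltc x (inT x))].
have CE x : val (C x) = c x by rewrite ffunE.
have CP x (a : 'I_k) : C x = a <-> c x = val a.
  by split=> [<-|E]; [rewrite CE | apply: val_inj; rewrite CE].
apply/existsP; exists C; apply/andP; split.
  apply/andP; split.
    apply/forallP => a; have [x [_ xa _]] := bc _ (ltn_ord a).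
    by apply/existsP; exists x; apply/eqP/CP.
  apply/forallP => x; apply/forallP => y; apply/implyP => xy.
  by apply: contraNneq (properc x y (inT x) (inT y) xy) => E; rewrite -!CE E.
apply/forallP => a; have [x [_ xa bx]] := bc _ (ltn_ord a).
apply/existsP; exists x; apply/andP; split; first exact/eqP/CP.
apply/eqP/setP => b; rewrite in_setC1; apply/imsetP/idP.
  case=> y; rewrite inE => xy ->.
  by apply: contraNneq (properc x y (inT x) (inT y) xy) => E; rewrite -!CE E.
move=> nba; have [|y [_ xy yb]] := bx (val b) (ltn_ord b).
  by apply: contraNneq nba => E; apply/eqP/val_inj; rewrite CE xa.
by exists y; [rewrite inE | apply/esym/CP].
Qed.

(* A new vertex [w] hangs from a single vertex [u] of a connected set [A]. The
   edge [uw] sees at most [degree u] colours there, and then [w] sees two. *)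
Lemma extend_partial_b_colouring k A c u w :
    acyclic_graph G -> 2 < k -> degree u < k ->
    connected_in A -> u \in A -> w \notin A -> adj u w ->
    partial_b_colouring k A c ->
  exists c', partial_b_colouring k (w |: A) c'.
Proof.
move=> acG k2 du cA uA wA uw [ltc properc bc].
have [e eE] := adj_edge uw.
have we : w \in val e by rewrite eE set22.
have ue : u \in val e by rewrite eE set21.
have onlyu v : v \in A -> adj w v -> v = u.
  by move=> vA wv; apply: (unique_neighbour acG cA wA) => //; rewrite adj_sym.
have onlye f : val f \subset w |: A -> w \in val f -> f = e.
  move=> fA wf; have [v wv fE] := edge_otherP wf; apply: val_inj; rewrite /= fE eE.
  suff -> : v = u by rewrite setUC.
  apply: onlyu => //; have /(subsetP fA) : v \in val f by rewrite fE set22.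
  by rewrite !inE => /predU1P[E|//]; have := adj_neq wv; rewrite E eqxx.
have [ce ltce] : exists2 a, a < k &
    a \notin c (inl u) :: [seq c (inr f) | f <- enum (incident u :\ e)].
  apply: fresh_colour; apply: leq_ltn_trans du.
  by rewrite /= size_map -cardE -card_incident (cardsD1 e) inE ue.
rewrite inE negb_or => /andP[ceu /mapP ceN].
have [cw ltcw] := @fresh_colour k [:: c (inl u); ce] k2.
rewrite !inE negb_or => /andP[cwu cwe].
(* All edges at [w] get the colour [ce], but by [onlye] the edge [e] is the only one of them inside
   [w |: A]. *)
pose c' (x : element G) := match x with
  | inl v => if v == w then cw else c x
  | inr f => if w \in val f then ce else c x end.
have inA x : inside A x -> c' x = c x.
  case: x => [v|f] /= xA; case: ifP => //.
    by move/eqP=> E; rewrite -E xA in wA.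
  by move/(subsetP xA); rewrite (negPf wA).
have cases x : inside (w |: A) x -> [\/ inside A x, x = inl w | x = inr e].
  case: x => [v|f] /=.
    by rewrite !inE => /predU1P[->|]; [apply: Or32 | apply: Or31].
  move=> fA; case: (boolP (w \in val f)) => [wf|wf].
    by apply: Or33; rewrite (onlye f).
  apply: Or31; apply/subsetP => v vf; have /setU1P[E|//] := subsetP fA v vf.
  by rewrite -E vf in wf.
have c'w : c' (inl w) = cw by rewrite /c' eqxx.
have c'e : c' (inr e) = ce by rewrite /c' we.
have wx x : inside A x -> tadj x (inl w) -> c x != cw.
  case: x => [v|f] /= xA; last by move/(subsetP xA); rewrite (negPf wA).
  by rewrite adj_sym => /(onlyu _ xA) ->; rewrite eq_sym.
have ex x : inside A x -> tadj x (inr e) -> c x != ce.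
  case: x => [v|f] /= xA.
    by rewrite eE !inE => /orP[]/eqP E; [rewrite E eq_sym | rewrite -E xA in wA].
  case/andP=> nfe /set0Pn[v]; rewrite eE !inE => /andP[vf /orP[]/eqP E].
    apply: contraPneq ceN => <- H; apply: H; exists f => //.
    by rewrite mem_enum !inE nfe -E.
  by rewrite -E (subsetP xA) in wA.
exists c'; split.
- move=> x /cases[xA|->|->]; [by rewrite inA ?ltc | by rewrite c'w | by rewrite c'e].
- have half x y : inside A x -> inside (w |: A) y -> tadj x y -> c' x != c' y.
    move=> xA /cases[yA|->|->]; rewrite (inA x) //.
    + by rewrite (inA y) //; apply: properc.
    + by rewrite c'w; apply: wx.
    + by rewrite c'e; apply: ex.
  move=> x y xwA ywA xy; case: (cases x xwA) => [xA|xE|xE]; first exact: half.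
    case: (cases y ywA) => [yA|yE|yE].
    + by rewrite eq_sym half // tadj_sym.
    + by rewrite xE yE /= adj_irrefl in xy.
    + by rewrite xE yE c'w c'e.
  case: (cases y ywA) => [yA|yE|yE].
  + by rewrite eq_sym half // tadj_sym.
  + by rewrite xE yE c'w c'e eq_sym.
  + by rewrite xE yE /= eqxx in xy.
- move=> a /bc[x [xA xa bx]]; exists x.
  split; [exact: inside_subset (subsetUr _ _) xA | by rewrite inA | move=> b ltb nba].
  have [y [yA xy yb]] := bx b ltb nba; exists y.
  by split; [exact: inside_subset (subsetUr _ _) yA | | rewrite inA].
Qed.

(** Induction on the number of vertices outside [A]: either some edge leaves [A] and its outer end
    is added, or [A] is closed under adjacency and is everything by connectedness. *)
Lemma partial_to_total k A c v :
    connected_graph G -> acyclic_graph G -> 2 < k -> (forall u, degree u < k) ->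
    connected_in A -> v \in A -> partial_b_colouring k A c ->
  has_total_b_colouring G k.
Proof.
move=> conG acG k2 degk; have [n] := ubnP #|~: A|.
elim: n A c => // n IHn A c; rewrite ltnS => leAn cA vA pc.
case: (boolP [exists u in A, exists w, adj u w && (w \notin A)]) => [|noext].
  case/exists_inP=> u uA /existsP[w /andP[uw wA]].
  have [c' pc'] := extend_partial_b_colouring acG k2 (degk u) cA uA wA uw pc.
  apply: (IHn (w |: A) c') => //; last by rewrite inE vA orbT.
    apply: leq_trans leAn; apply: proper_card; rewrite properC properE subsetUr.
    by apply/subsetPn; exists w; rewrite ?inE ?eqxx.
  exact: connected_inU1 cA uA uw.
suff AT : A = setT by apply: (@partial_b_colouring_setT _ c); rewrite -AT.
apply/setP => x; rewrite inE; apply: (adj_closed_setT conG vA) => u w uA uw.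
apply: contraNT noext => wA; apply/exists_inP; exists u => //.
by apply/existsP; exists w; rewrite uw.
Qed.

End PartialColourings.

(** * Encoded coloured trees and their realisation in a graph *)

(* A rooted tree on [0, n) is encoded by its sequence [par] of parents, with
   [par_j < j] for [0 < j] (entry 0 is junk). [inl i] stands for the vertex [i]
   and [inr j], [0 < j], for the edge joining [j] to its parent. *)
Section Templates.
Implicit Types (par vc ec : seq nat) (s t : nat + nat).

Definition template_elements par : seq (nat + nat) :=
  map inl (iota 0 (size par)) ++ map inr (iota 1 (size par).-1).

(** Edges are named by their child ends, so two distinct edges meet when one child is the parent of
    the other or when the parents coincide. *)
Definition template_adj par s t : bool :=
  match s, t with
  | inl i, inl j => (i < j) && (nth 0 par j == i) || (j < i) && (nth 0 par i == j)
  | inl i, inr j | inr j, inl i => (i == j) || (i == nth 0 par j)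
  | inr i, inr j => (i != j) &&
      [|| i == nth 0 par j, nth 0 par i == j | nth 0 par i == nth 0 par j]
  end.

Definition template_colour vc ec s : nat :=
  match s with inl i => nth 0 vc i | inr j => nth 0 ec j end.

(** A Boolean counterpart of [partial_b_colouring], so that concrete templates are checked by
    computation. *)
Definition template_ok k par vc ec : bool :=
  let E := template_elements par in
  let c := template_colour vc ec in
  [&& all (fun s => c s < k) E,
      all (fun s => all (fun t => template_adj par s t ==> (c s != c t)) E) E &
      all (fun a => has (fun s => (c s == a) && all (fun b => (b != a) ==>
        has (fun t => template_adj par s t && (c t == b)) E) (iota 0 k)) E) (iota 0 k)].

Definition parents_ok par : bool :=
  (0 < size par) && all (fun j => nth 0 par j < j) (iota 1 (size par).-1).

Variable G : sgraph.
Implicit Types (p : seq G) (x y : element G).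

(** The vertex [r] is only the default of [nth]. Only the template edges are demanded; in an acyclic
    graph the non-edges follow. *)
Definition realises (r : G) par p : Prop :=
  [/\ uniq p, size p = size par &
    forall j, 0 < j < size par -> adj (nth r p (nth 0 par j)) (nth r p j)].

Section Realised.
Variables (r : G) (par : seq nat) (p : seq G).
Hypotheses (acG : acyclic_graph G) (par_ok : parents_ok par) (rp : realises r par p).

Let n := size par.

Lemma parent_lt j : 0 < j < n -> nth 0 par j < j.
Proof.
case/andP: par_ok => n0 /allP le /andP[j0 ltj]; apply: le.
by rewrite mem_iota j0 /= add1n prednK.
Qed.

(** Each listed vertex hangs from an earlier one. Prefixes are treated so that [unique_neighbour]
    can be applied to the next vertex. *)
Lemma realised_connected j : 0 < j <= n -> connected_in [set x in take j p].
Proof.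
have [_ sp adjp] := rp; elim: j => // j IHj; rewrite ltnS => /andP[_ ltjn].
have E : [set x in take j.+1 p] = nth r p j |: [set x in take j p].
  by apply/setP => x; rewrite (take_nth r) ?sp // !inE mem_rcons inE.
rewrite E; case: (posnP j) => [->|j0].
  rewrite take0; have -> : [set x in [::]] = set0 :> {set G} by apply/setP => x; rewrite !inE.
  by rewrite setU0; apply: connected_in1.
have j0n : 0 < j < n by rewrite j0.
apply: (connected_inU1 _ _ (adjp j j0n)); first by apply: IHj; rewrite j0 ltnW.
rewrite inE -(nth_take r (parent_lt j0n)) mem_nth //.
by rewrite size_takel ?parent_lt // sp ltnW.
Qed.

(** The prefix before position [j] is connected, so the vertex there has at most one neighbour in
    it, namely its parent. *)
Lemma realised_adj_lt i j :
  i < j -> j < n -> adj (nth r p i) (nth r p j) = (nth 0 par j == i).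
Proof.
have [up sp adjp] := rp => ltij ltjn.
have j0 : 0 < j by apply: leq_ltn_trans ltij.
have j0n : 0 < j < n by rewrite j0.
have szt : size (take j p) = j by rewrite size_takel // sp ltnW.
have inj m : m < j -> nth r p m \in [set x in take j p].
  move=> ltmj; by rewrite inE -(nth_take r ltmj) mem_nth // szt.
apply/idP/eqP => [ij|<-]; last exact: adjp.
have ltpn : nth 0 par j < n by apply: ltn_trans ltjn; apply: parent_lt.
apply/eqP; rewrite -(nth_uniq r _ _ up) ?sp ?(ltn_trans ltij) //; apply/eqP.
apply: (@unique_neighbour _ _ (nth r p j) _ _ acG (@realised_connected j _) _ (inj _ _) (inj _ _)).
- by rewrite j0 ltnW.
- rewrite inE; apply/negP => /(nthP r)[m]; rewrite szt => ltmj.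
  rewrite nth_take // => /eqP; rewrite nth_uniq ?sp ?(ltn_trans ltmj) //.
  by rewrite ltn_eqF.
- exact: parent_lt.
- exact: ltij.
- by rewrite adj_sym adjp.
- by rewrite adj_sym.
Qed.

Lemma realised_adj i j : i < n -> j < n ->
  adj (nth r p i) (nth r p j) = template_adj par (inl i) (inl j).
Proof.
move=> lti ltj /=; case: (ltngtP i j) => [ltij|ltji|->] /=.
- by rewrite realised_adj_lt // orbF.
- by rewrite adj_sym realised_adj_lt.
- by rewrite adj_irrefl.
Qed.

Definition stands_for s x : bool :=
  match s, x with
  | inl i, inl v => (i < n) && (v == nth r p i)
  | inr j, inr f => (0 < j < n) && (val f == [set nth r p j; nth r p (nth 0 par j)])
  | _, _ => false
  end.

Let in_p (i j : nat) : i < n -> j < n -> (nth r p i == nth r p j) = (i == j).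
Proof. by have [up sp _] := rp => lti ltj; rewrite nth_uniq ?sp. Qed.

Let par_n j : 0 < j < n -> nth 0 par j < n.
Proof. by move=> jn; apply: ltn_trans (parent_lt jn) _; case/andP: jn. Qed.

Lemma stands_for_adj s t x y :
  stands_for s x -> stands_for t y -> tadj x y = template_adj par s t.
Proof.
case: s t x y => [i|i] [j|j] [u|f] [v|g] //=.
- by case/andP=> lti /eqP-> /andP[ltj /eqP->]; rewrite realised_adj.
- case/andP=> lti /eqP-> /andP[jn /eqP->].
  by rewrite !inE !in_p ?par_n //; case/andP: jn.
- case/andP=> jn /eqP-> /andP[lti /eqP->].
  by rewrite !inE !in_p ?par_n //; case/andP: jn.
case/andP=> im /eqP fE /andP[jm /eqP gE].
have [i0 lti] := andP im; have [j0 ltj] := andP jm.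
have lpi := parent_lt im; have lpj := parent_lt jm.
have pin := par_n im; have pjn := par_n jm.
(* An edge determines its child end: otherwise [i] and [j] would each be the parent of the other,
   whereas a parent precedes its child. *)
have -> : (f != g) = (i != j).
  congr (~~ _); apply/eqP/eqP => [fg|ij]; last by apply: val_inj; rewrite /= fE gE ij.
  have : nth r p i \in val g by rewrite -fg /= fE set21.
  have : nth r p j \in val f by rewrite fg /= gE set21.
  rewrite /= fE gE !inE !in_p // => /orP[/eqP-> //|/eqP jE] /orP[/eqP-> //|/eqP iE].
  by move: lpi lpj; rewrite -jE -iE => /ltn_trans/[apply]; rewrite ltnn.
case: eqP => //= /eqP nij; rewrite fE gE; apply/set0Pn/idP => [[v]|].
  rewrite !inE => /andP[/orP[]/eqP-> /orP[]]; rewrite in_p //.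
  - by move=> E; rewrite E in nij.
  - by move=> ->.
  - by move=> ->; rewrite orbT.
  - by move=> ->; rewrite !orbT.
case/or3P=> /eqP E.
- by exists (nth r p i); rewrite !inE -E !eqxx orbT.
- by exists (nth r p j); rewrite !inE E !eqxx orbT.
- by exists (nth r p (nth 0 par i)); rewrite !inE E !eqxx !orbT.
Qed.

Let A := [set x in p].

Lemma stands_for_inside s x :
  stands_for s x -> inside A x /\ s \in template_elements par.
Proof.
have [_ sp _] := rp.
case: s x => [i|j] [v|f] //= => [/andP[lti /eqP->]|/andP[jn /eqP->]]; rewrite mem_cat.
  by rewrite inE mem_nth ?sp // mem_map ?mem_iota /= ?add0n ?lti // => a b [].
have ltj := andP jn; split.
  by apply/subsetP => v; rewrite !inE => /orP[]/eqP->; rewrite mem_nth // sp ?par_n //; case: ltj.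
apply/orP; right; rewrite mem_map; last by move=> a b [].
by rewrite mem_iota add1n prednK //; case: ltj => j0; apply: ltn_trans.
Qed.

Lemma template_stands_for s :
  s \in template_elements par -> exists x, stands_for s x.
Proof.
have [_ sp adjp] := rp; have [n0 _] := andP par_ok.
rewrite mem_cat => /orP[]/mapP[i]; rewrite mem_iota => lti ->.
  by exists (inl (nth r p i)); rewrite /= eqxx andbT.
rewrite add1n prednK // in lti.
have [f fE] := adj_edge (adjp i lti); exists (inr f).
by rewrite /= lti fE setUC eqxx.
Qed.

(** The realised tree is an induced subgraph: by [realised_adj_lt], an edge between listed vertices
    joins the later one to its parent. *)
Lemma inside_stands_for x : inside A x -> exists s, stands_for s x.
Proof.
have [_ sp _] := rp; case: x => [v|f] /=.
  rewrite inE => vp; exists (inl (index v p)).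
  by rewrite /= nth_index // -[n]sp index_mem vp eqxx.
move=> fA; have [u [v [uv fE]]] := edgeP f.
have [up vp] : u \in p /\ v \in p.
  by split; rewrite -[_ \in p](in_set (mem p)) (subsetP fA) // fE ?set21 ?set22.
move: uv fE; rewrite -(nth_index r up) -(nth_index r vp).
move: up vp; rewrite -!index_mem sp -/n.
move: (index u p) (index v p) => i j lti ltj.
wlog ltij : i j lti ltj / i < j => [IH|ij fE].
  case: (ltngtP i j) => [ltij|ltji|->]; first exact: IH.
  - by rewrite adj_sym setUC; apply: IH.
  - by rewrite adj_irrefl.
exists (inr j); rewrite /= fE ltj (leq_ltn_trans _ ltij) //=.
by move: ij; rewrite realised_adj_lt // => /eqP ->; rewrite setUC.
Qed.

Lemma template_partial_b_colouring k vc ec : template_ok k par vc ec ->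
  exists c, partial_b_colouring k A c.
Proof.
case/and3P=> /allP ltc /allP properc /allP bc.
(* The vertex listed last in an edge is the child, whose position names the edge. *)
pose c x := match x with
  | inl v => nth 0 vc (index v p)
  | inr f => nth 0 ec (\max_(v in val f) index v p) end.
have [up sp _] := rp.
have cE s x : stands_for s x -> c x = template_colour vc ec s.
  case: s x => [i|j] [v|f] //= => [/andP[lti /eqP->]|/andP[jn /eqP->]].
    by rewrite index_uniq // sp.
  have lpj := parent_lt jn; have pjn := par_n jn; have [_ ltj] := andP jn.
  rewrite big_setU1 ?inE ?in_p ?gtn_eqF //= big_set1 !index_uniq ?sp //; congr nth.
  by apply/maxn_idPl/ltnW.
exists c; split.
- move=> x /inside_stands_for[s sx]; rewrite (cE s x sx); apply: ltc.
  by case: (stands_for_inside sx).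
- move=> x y /inside_stands_for[s sx] /inside_stands_for[t ty].
  rewrite (cE s x sx) (cE t y ty) (stands_for_adj sx ty).
  have [_ sE] := stands_for_inside sx; have [_ tE] := stands_for_inside ty.
  by move/allP: (properc s sE) => /(_ t tE)/implyP.
- move=> a lta; have /bc/hasP[s sE /andP[/eqP sa /allP sb]] : a \in iota 0 k by rewrite mem_iota.
  have [x sx] := template_stands_for sE.
  exists x; have [xA _] := stands_for_inside sx.
  split=> //; first by rewrite (cE s).
  move=> b ltb nba; have /sb/implyP/(_ nba)/hasP[t tE /andP[st /eqP tb]] : b \in iota 0 k.
    by rewrite mem_iota.
  have [y ty] := template_stands_for tE.
  exists y; have [yA _] := stands_for_inside ty.
  by split=> //; rewrite ?(stands_for_adj sx ty) ?(cE t).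
Qed.

Lemma template_total k vc ec :
    connected_graph G -> 2 < k -> (forall u : G, degree u < k) ->
  template_ok k par vc ec -> has_total_b_colouring G k.
Proof.
move=> conG k2 degk /template_partial_b_colouring[c pc].
have [_ sp _] := rp; have [n0 _] := andP par_ok.
apply: (partial_to_total (A := A) (c := c) (v := nth r p 0)) => //.
  have := @realised_connected n; rewrite take_oversize ?sp // => H.
  by apply: H; rewrite n0 /=.
by rewrite inE mem_nth ?sp.
Qed.

End Realised.
End Templates.

(** * Bounds on [m_t] for small trees, explicit colourings, and the case analysis *)

Section SmallTrees.
Variable G : sgraph.
Hypotheses (conG : connected_graph G) (acG : acyclic_graph G).
Implicit Types (u v w : G) (f : edge G) (x : element G) (S : {set G}).

Lemma leaf_neighbour u v w : degree u <= 1 -> adj u v -> adj u w -> v = w.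
Proof. by move/card_le1_eqP=> le1 uv uw; apply: le1; rewrite inE. Qed.

Lemma other_neighbour u v : 1 < degree u -> exists2 w, w != v & adj u w.
Proof.
move=> du; have : 0 < #|[set w | adj u w] :\ v|.
  by move: du; rewrite /degree (cardsD1 v); case: (_ \in _); rewrite ?ltnS //; apply: ltnW.
by case/card_gt0P=> w; rewrite !inE => /andP[]; exists w.
Qed.

Lemma subseq_of_card S (n : nat) : n <= #|S| ->
  exists s, [/\ uniq s, size s = n & {subset s <= S}].
Proof.
move=> leS; exists (take n (enum S)); split.
- by rewrite take_uniq ?enum_uniq.
- by rewrite size_takel // -cardE.
- by move=> v /mem_take; rewrite mem_enum.
Qed.

(** The set [S] with its pendant leaves is closed under adjacency, since a leaf has no neighbour
    besides its one in [S]; by connectedness it is the whole graph. *)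
Lemma core_leaves S u :
    u \in S -> (forall v w, v \in S -> adj v w -> w \notin S -> degree w <= 1) ->
  forall w, w \notin S -> degree w <= 1 /\ exists2 v, v \in S & adj v w.
Proof.
move=> uS core.
pose A := S :|: [set w | (degree w <= 1) && [exists v in S, adj v w]].
have inA : forall w, w \in A.
  apply: (adj_closed_setT (v := u) conG); first by rewrite inE uS.
  move=> v w; rewrite !inE; case: (boolP (w \in S)) => //= wS.
  case: (boolP (v \in S)) => [vS _|vS] /= vw.
    by rewrite (core v w) //; apply/exists_inP; exists v.
  case/andP: vw => dv /exists_inP[z zS zv] vw.
  by rewrite (leaf_neighbour dv vw (_ : adj v z)) ?zS // 1?adj_sym in wS.
move=> w /negPf wS; move: (inA w); rewrite !inE wS /= => /andP[dw /exists_inP[v vS vw]].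
by split=> //; exists v.
Qed.

Lemma m_t_leq_degree (d : nat) : (forall v, degree v <= d) -> m_t G <= d.*2.+1.
Proof.
move=> led; apply: m_t_leq; rewrite (_ : [set _ | _] = set0) ?cards0 //.
by apply/setP => x; rewrite !inE ltnNge d_t_leq.
Qed.

(** The graph is a star. Vertices other than [v] have total degree at most 2, below [(degree v).+1],
    and there are [degree v] edges, so [m_t_leq] applies. *)
Lemma m_t_star v :
  1 < degree v -> (forall u, adj v u -> degree u <= 1) -> m_t G <= (degree v).+1.
Proof.
move=> dv leaves; have core a b : a \in [set v] -> adj a b -> b \notin [set v] -> degree b <= 1.
  by rewrite inE => /eqP-> /leaves.
have dw w (nw : w \notin _) := (core_leaves (set11 v) core nw).1.
have vw w (nw : w \notin _) := (core_leaves (set11 v) core nw).2.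
apply: m_t_leq; rewrite card_element -add1n; apply: leq_add.
  apply: (@leq_trans #|[set v]|); last by rewrite cards1.
  apply: subset_leq_card; apply/subsetP => w; rewrite !inE d_t_vertex.
  apply: contraLR => nwv; rewrite add1n -leqNgt.
  by apply: leq_trans dv; rewrite (leq_double _ 1) dw // inE.
rewrite -card_incident; apply: subset_leq_card; apply/subsetP => f _; rewrite inE.
have [a [b [ab fE]]] := edgeP f; rewrite fE !inE.
case: (eqVneq v a) => //= nva; have nav : a \notin [set v] by rewrite inE eq_sym.
have [z /set1P -> va] := vw a nav; apply/eqP.
by apply: (leaf_neighbour (dw a nav)) ab; rewrite adj_sym.
Qed.

(** The graph is a path on at most four vertices. Total degree 4 requires a vertex of degree 2 or an
    edge with both ends of degree 2, which leaves only [u], [v] and the edge between them. *)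
Lemma m_t_double_star u v :
    (forall w, degree w <= 2) -> adj u v ->
    (forall w, adj u w -> w != v -> degree w <= 1) ->
    (forall w, adj v w -> w != u -> degree w <= 1) ->
  m_t G <= 4.
Proof.
move=> deg2 uv leaf_u leaf_v; have core a b : a \in [set u; v] -> adj a b -> b \notin [set u; v] -> degree b <= 1.
  by rewrite !inE negb_or => /orP[]/eqP-> ab /andP[nu nv]; [apply: leaf_u | apply: leaf_v].
have dw w (nw : w \notin _) := (core_leaves (set21 u v) core nw).1.
have [e eE] := adj_edge uv.
apply: m_t_leq; rewrite card_element -[4]/(2 + 2); apply: leq_add.
  apply: (@leq_trans #|[set u; v]|); last by rewrite cards2; case: eqP.
  apply: subset_leq_card; apply/subsetP => w; rewrite inE inE d_t_vertex.
  apply: contraLR => /dw dw1; rewrite -ltnNge.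
  by rewrite (@leq_ltn_trans 2) // (leq_double _ 1).
apply: (@leq_trans #|[set e]|); last by rewrite cards1.
apply: subset_leq_card; apply/subsetP => f; rewrite !inE.
have [a [b [ab fE]]] := edgeP f => le4.
have := leq_trans le4 (d_t_edge fE); move: (deg2 a) (deg2 b).
have inS z : 1 < degree z -> z \in [set u; v].
  by apply: contraLR => /dw; rewrite -leqNgt.
move=> a2 b2 ab4.
have /inS : 1 < degree a by move: ab4; case: (degree a) a2 b2 => [|[]//] _; case: (degree b) => [|[|[]]].
have /inS : 1 < degree b by move: ab4; case: (degree b) b2 a2 {inS} => [|[]//] _; case: (degree a) => [|[|[]]].
rewrite !inE => bE aE; apply/eqP/val_inj; rewrite /= fE eE.
case/orP: aE ab => /eqP->; case/orP: bE => /eqP->; rewrite ?adj_irrefl // => _.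
exact: setUC.
Qed.

Lemma not_triangle u v w : adj u v -> adj v w -> ~~ adj w u.
Proof.
move=> uv vw; apply/negP => wu; apply: (acG (p := [:: u; v; w])) => //.
rewrite /ucycle /= uv vw wu !inE !(negb_or, adj_neq) //.
by rewrite adj_sym.
Qed.

Lemma not_square u v w z :
  u != w -> v != z -> adj u v -> adj v w -> adj w z -> ~~ adj z u.
Proof.
move=> nuw nvz uv vw wz; apply/negP => zu; apply: (acG (p := [:: u; v; w; z])) => //.
rewrite /ucycle /= uv vw wz zu !inE !negb_or nuw nvz !adj_neq //.
by rewrite adj_sym.
Qed.

Lemma total_edge u v :
  adj u v -> (forall w, degree w <= 2) -> has_total_b_colouring G 3.
Proof.
move=> uv deg2.
(* The lists are the parents, the vertices, the vertex colours and the edge colours; entry 0 of the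
   parents and of the edge colours is a placeholder. The three elements of an edge are pairwise
   adjacent, so distinct colours make them all b-chromatic. *)
apply: (@template_total G u [:: 0; 0] [:: u; v] acG _ _ 3 [:: 0; 2] [:: 0; 1]) => //.
by split=> //= [|[|[|j]]] //; rewrite inE andbT adj_neq.
Qed.

(** The centre and its edges are pairwise adjacent and carry all the colours, so each is
    b-chromatic; the leaves only have to avoid conflicts. The same holds in [total_star4]. *)
Lemma total_star3 v : degree v = 3 -> (forall w, degree w <= 3) ->
  has_total_b_colouring G 4.
Proof.
move=> dv deg3; have [|s [us ss sN]] := @subseq_of_card [set u | adj v u] 3.
  by rewrite -dv.
case: s us ss sN => [|a [|b [|c []]]] // us _ sN.
have adjv z : z \in [:: a; b; c] -> adj v z by move/sN; rewrite inE.
apply: (@template_total G v [:: 0; 0; 0; 0] [:: v; a; b; c] acG _ _ 4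
  [:: 0; 2; 1; 1] [:: 0; 1; 2; 3]) => //.
split=> //; last by move=> [|[|[|[|j]]]] //= _; apply: adjv; rewrite !inE eqxx ?orbT.
by rewrite cons_uniq us andbT; apply/negP => /adjv; rewrite adj_irrefl.
Qed.

Lemma total_star4 v : degree v = 4 -> (forall w, degree w <= 4) ->
  has_total_b_colouring G 5.
Proof.
move=> dv deg4; have [|s [us ss sN]] := @subseq_of_card [set u | adj v u] 4.
  by rewrite -dv.
case: s us ss sN => [|a [|b [|c [|d []]]]] // us _ sN.
have adjv z : z \in [:: a; b; c; d] -> adj v z by move/sN; rewrite inE.
apply: (@template_total G v [:: 0; 0; 0; 0; 0] [:: v; a; b; c; d] acG _ _ 5
  [:: 0; 2; 1; 1; 1] [:: 0; 1; 2; 3; 4]) => //.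
split=> //; last by move=> [|[|[|[|[|j]]]]] //= _; apply: adjv; rewrite !inE eqxx ?orbT.
by rewrite cons_uniq us andbT; apply/negP => /adjv; rewrite adj_irrefl.
Qed.

Lemma total_fork v u : degree v = 3 -> adj v u -> 1 < degree u ->
  (forall w, degree w <= 3) -> has_total_b_colouring G 5.
Proof.
move=> dv vu du deg3; have [w nwv uw] := other_neighbour v du.
have [|s [us ss sN]] := @subseq_of_card ([set z | adj v z] :\ u) 2.
  by move: dv; rewrite /degree (cardsD1 u) inE vu add1n => -[->].
case: s us ss sN => [|a [|b []]] // us _ sN.
have adjv z : z \in [:: a; b] -> z != u /\ adj v z.
  by move/sN; rewrite !inE => /andP[].
have [nau va] : a != u /\ adj v a by apply: adjv; rewrite inE eqxx.
have [nbu vb] : b != u /\ adj v b by apply: adjv; rewrite !inE eqxx orbT.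
have nvw : ~~ adj v w by rewrite adj_sym (not_triangle vu uw).
(* The centre [v] and its three edges carry 0 to 3 and each sees 4 on a neighbour of [v]. Colour 4
   is b-chromatic at [u], which sees 0 on [v], 3 on [uv], 1 on [uw] and 2 on [w]. *)
apply: (@template_total G v [:: 0; 0; 0; 0; 3] [:: v; a; b; u; w] acG _ _ 5
  [:: 0; 4; 4; 4; 2] [:: 0; 1; 2; 3; 1]) => //; last by move=> z; apply: leq_trans (deg3 z) _.
split=> //; last by move=> [|[|[|[|[|j]]]]].
have naw : a != w by apply: contraNneq nvw => <-.
have nbw : b != w by apply: contraNneq nvw => <-.
move: us; rewrite /= !inE !negb_or !andbT => nab.
by rewrite (adj_neq va) (adj_neq vb) (adj_neq vu) (adj_neq uw) (eq_sym v) nwv nab nau naw nbu nbw.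
Qed.

(* Along a path, vertices and edges alternately take the colours 0, 1, 2, ...
   modulo [k]. *)
Lemma total_path4 u v : adj u v -> 1 < degree u -> 1 < degree v ->
  (forall w, degree w <= 2) -> has_total_b_colouring G 4.
Proof.
move=> uv du dv deg2; have [a nav ua] := other_neighbour v du.
have [d ndu vd] := other_neighbour u dv.
have nud : ~~ adj u d by rewrite adj_sym (not_triangle uv vd).
apply: (@template_total G u [:: 0; 0; 1; 2] [:: a; u; v; d] acG _ _ 4
  [:: 0; 2; 0; 2] [:: 0; 1; 3; 1]) => //; last by move=> z; apply: leq_trans (deg2 z) _.
split=> //; last by move=> [|[|[|[|j]]]] //=; rewrite adj_sym.
have nad : a != d by apply: contraNneq nud => <-.
by rewrite /= !inE !negb_or nav nad (eq_sym a) (adj_neq ua) (adj_neq uv) (adj_neq vd) (eq_sym u) ndu.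
Qed.

(** In the alternating order an inner element sees the two elements before it and the two after it,
    hence all other residues modulo 5. The five elements from [a] to [b] have distinct colours. *)
Lemma total_path5 v a b : adj v a -> adj v b -> a != b -> 1 < degree a -> 1 < degree b ->
  (forall w, degree w <= 2) -> has_total_b_colouring G 5.
Proof.
move=> va vb nab da db deg2; have [a' na'v aa'] := other_neighbour v da.
have [b' nb'v bb'] := other_neighbour v db.
have nva' : ~~ adj v a' by rewrite adj_sym (not_triangle va aa').
have nvb' : ~~ adj v b' by rewrite adj_sym (not_triangle vb bb').
(* Equality would close the square [v], [a], [a'], [b]. *)
have na'b' : a' != b'.
  apply/eqP => E; have av : adj a v by rewrite adj_sym.
  have := not_square nab (_ : v != b') av vb bb'.
  by rewrite eq_sym nb'v -E adj_sym aa' => /(_ isT).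
apply: (@template_total G v [:: 0; 0; 1; 2; 3] [:: a'; a; v; b; b'] acG _ _ 5
  [:: 0; 2; 4; 1; 3] [:: 0; 1; 3; 0; 2]) => //; last by move=> z; apply: leq_trans (deg2 z) _.
split=> //; last by move=> [|[|[|[|[|j]]]]] //= _; rewrite adj_sym.
have na'b : a' != b by apply: contraNneq nva' => ->.
have nab' : a != b' by apply: contraNneq nvb' => <-.
by rewrite /= !inE !negb_or na'v na'b na'b' nab nab' (eq_sym v b') nb'v (eq_sym a' a) (eq_sym a v)
  (adj_neq aa') (adj_neq va) (adj_neq vb) (adj_neq bb').
Qed.

(** Greedy extension requires [2 < k], so the constant colouring is given on the whole graph at
    once. *)
Lemma total_edgeless v : (forall w, degree w = 0) -> has_total_b_colouring G 1.
Proof.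
move=> deg0; have nadj (x y : element G) : tadj x y = false.
  apply/negP => xy; have := @d_t_leq G 0 x; rewrite leqn0 /d_t cards_eq0 => H.
  have /eqP/setP/(_ y) : N_t x == set0 by apply: H => w; rewrite deg0.
  by rewrite !inE xy.
apply: (@partial_b_colouring_setT _ _ (fun=> 0)); split=> // [x y _ _|[]//].
  by rewrite nadj.
by exists (inl v); split=> //=; rewrite ?inE // => -[].
Qed.

Lemma tree_total_b_colouring v : m_t G <= 5 ->
  exists2 k, has_total_b_colouring G k & m_t G <= k.
Proof.
move=> m5; have deg4 w : degree w <= 4 by rewrite -ltnS (leq_trans (degree_lt_m_t w)).
have cases d : (forall w, degree w <= d.+1) ->
    (exists w : G, degree w = d.+1) \/ (forall w : G, degree w <= d).
  move=> led; case: (boolP [exists w : G, degree w == d.+1]) => [/existsP[w /eqP]|].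
    by left; exists w.
  rewrite negb_exists => /forallP nd; right=> w.
  by rewrite -ltnS ltn_neqAle nd led.
case: (cases _ deg4) => [[w dw]|deg3]; first by exists 5 => //; apply: (total_star4 dw).
case: (cases _ deg3) => [[w dw]|deg2].
  case: (boolP [exists u, adj w u && (1 < degree u)]) => [/existsP[u /andP[wu du]]|].
    by exists 5 => //; apply: (total_fork dw wu du).
  rewrite negb_exists => /forallP nfork; exists 4; first exact: (total_star3 dw).
  rewrite -[4]/3.+1 -dw; apply: m_t_star; rewrite ?dw // => u wu.
  by have := nfork u; rewrite wu /= -leqNgt.
case: (cases _ deg2) => [[w dw]|deg1]; last first.
  case: (cases _ deg1) => [[w dw]|deg0].
    exists 3; last exact: m_t_leq_degree deg1.
    have /card_gt0P[u] : 0 < degree w by rewrite dw.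
    by rewrite inE => wu; apply: (total_edge wu) => z; apply: leq_trans (deg1 z) _.
  exists 1; last exact: m_t_leq_degree deg0.
  by apply: (total_edgeless v) => z; apply/eqP; rewrite -leqn0.
(* Maximum degree 2: the middle vertex of a [P_5] is one with two neighbours of degree at least
   2. *)
case: (boolP [exists z : G, exists a : G, exists b : G,
    [&& adj z a, adj z b, a != b, 1 < degree a & 1 < degree b]]) => [|noP5].
  case/existsP=> z /existsP[a /existsP[b /and5P[za zb nab da db]]].
  by exists 5 => //; apply: (total_path5 za zb nab da db).
have noP5' (z a b : G) : adj z a -> adj z b -> b != a -> 1 < degree a -> degree b <= 1.
  move=> za zb nba da; rewrite leqNgt; apply: contra noP5 => db.
  apply/existsP; exists z; apply/existsP; exists a; apply/existsP; exists b.
  by rewrite za zb eq_sym nba da db.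
case: (boolP [exists u, adj w u && (1 < degree u)]) => [/existsP[u /andP[wu du]]|].
  have dw1 : 1 < degree w by rewrite dw.
  exists 4; first exact: (total_path4 wu dw1 du).
  (* Without a [P_5], any further neighbour of [w] or of [u] is a leaf. *)
  apply: (m_t_double_star deg2 wu) => z zz nz; [exact: noP5' wu zz nz du|].
  by apply: noP5' (_ : adj u w) zz nz dw1; rewrite adj_sym.
rewrite negb_exists => /forallP nfork.
have /card_gt0P[u] : 0 < degree w by rewrite dw.
rewrite inE => wu; exists 3; first exact: (total_edge wu).
(* All neighbours of [w] are leaves, so the tree is [P_3], a star with centre of degree 2. *)
rewrite -[3]/2.+1 -dw; apply: m_t_star; rewrite ?dw // => z wz.
by have := nfork z; rewrite wz /= -leqNgt.
Qed.

End SmallTrees.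

Theorem theorem2 (T : sgraph) (hT : is_caterpillar T) (hm : m_t T <= 5) :
  phi_t T = m_t T.
Proof.
case: hT => -[/card_gt0P[v _] conT acT] _; apply/eqP; rewrite eqn_leq phi_t_leq_m_t /=.
have [k /leq_phi_t lek] := tree_total_b_colouring conT acT v hm.
by move/leq_trans; apply.
Qed.
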